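(* Fix an integer $r\ge 1$. Let $(A_j)_{j\ge 1}$ be any infinite sequence of transition matrices of type $r$ random walks (on finite Abelian groups $G_j$, with $|G_j|\to\infty$ allowed). Then the family $(A_j)$ does not have sharp cut off; that is, there exists $\epsilon\in(0,\tfrac12)$ such that $\dfrac{t_{A_j}(\epsilon)}{t_{A_j}(1-\epsilon)}$ does not converge to $1$ as $j\to\infty$.
   Context: A random walk on a finite Abelian group $G$ is of type $r$ if $|G|\ge \pi^r$ and there are elements $a_1,\dots,a_r\in G$ (generating $G$, so the walk is irreducible) such that at each step the walk moves from $x$ to $x+s$, where $s$ is chosen uniformly from the $2r+1$ steps $+a_1,-a_1,\dots,+a_r,-a_r,0$ (each with probability $\frac1{2r+1}$). Equivalently it is the simple random walk on the Cayley graph of $G$ with generating set $\{\pm a_i\}$, where staying put has the same probability as following each edge. Let $A$ be its (symmetric, irreducible) transition matrix, ${\bf v}_0$ the uniform stationary distribution ($A{\bf v}_0={\bf v}_0$, $|{\bf v}_0|_1=1$), and ${\bf x}_0$ the point mass at the identity. Define $d_A(t)=|A^t{\bf x}_0-{\bf v}_0|_1$ for integers $t\ge0$ and $t_A(d)=\max\{t : d_A(t)\ge d\}$. A family $(A_j)$ of irreducible symmetric Markov matrices has sharp cut off if $\lim_{j\to\infty} t_{A_j}(\epsilon)/t_{A_j}(1-\epsilon)=1$ for every $\epsilon\in(0,\tfrac12)$. *)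

(* Defs.v *)
From HB Require Import structures.
From mathcomp Require Import all_boot all_order all_algebra.
From Stdlib Require Import Reals ClassicalEpsilon ZArith.

Set Implicit Arguments.
Unset Strict Implicit.
Unset Printing Implicit Defensive.
Import GRing.Theory Num.Theory.

Local Open Scope ring_scope.

Definition generates (G : finZmodType) (r : nat) (a : 'I_r -> G) : Prop :=
  forall x : G, exists c : 'I_r -> int, x = \sum_(i < r) a i *~ c i.

(* Distribution A^t x_0 of the walk after t steps, started at the identity 0:
   each step adds s, chosen uniformly among the 2r+1 steps
   +a_1,-a_1,...,+a_r,-a_r,0. *)
Fixpoint walk_dist (G : finZmodType) (r : nat) (a : 'I_r -> G) (t : nat)
    : {ffun G -> rat} :=
  match t with
  | 0 => [ffun x => (x == 0)%:R]
  | t'.+1 =>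
      [ffun x => ((2 * r).+1)%:R^-1 *
         (walk_dist a t' x
          + \sum_(i < r) (walk_dist a t' (x - a i) + walk_dist a t' (x + a i)))]
  end.

Definition dA_rat (G : finZmodType) (r : nat) (a : 'I_r -> G) (t : nat) : rat :=
  \sum_(x : G) `|walk_dist a t x - (#|G|%:R)^-1|.

Definition int_to_Z (z : int) : Z :=
  match z with
  | Posz n => Z.of_nat n
  | Negz n => (- Z.of_nat n.+1)%Z
  end.

Definition rat_to_R (q : rat) : R :=
  Rdiv (IZR (int_to_Z (numq q))) (IZR (int_to_Z (denq q))).

Definition dA (G : finZmodType) (r : nat) (a : 'I_r -> G) (t : nat) : R :=
  rat_to_R (dA_rat a t).

(* t_A(d) = max { t : d_A(t) >= d } (chosen by classical description;
   the maximum exists for every d > 0 for these walks). *)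
Definition tA (G : finZmodType) (r : nat) (a : 'I_r -> G) (d : R) : nat :=
  epsilon (inhabits 0%N)
    (fun t => Rge (dA a t) d /\ forall t', Rge (dA a t') d -> (t' <= t)%coq_nat).

(* Main.v *)
(* Let N = 2r+1. The characters chi of G diagonalise the walk, with eigenvalue
   1 - D(chi)^2 / N, where D(chi)^2 = sum_l |chi(a_l) - 1|^2. As D(chi / chi') is the
   Euclidean distance between the points (chi(a_l))_l and (chi'(a_l))_l of C^r = R^(2r),
   cubes of side proportional to the least nonzero value D0 of D contain at most one
   character each, so the number of chi with D(chi) <= k D0 grows polynomially in k, with
   degree at most 2r. Hence sum_{chi <> 1} lambda_chi^(2t), which bounds d_A(t)^2, is small
   once t exceeds a constant (depending only on r) times the relaxation time N / D0^2. On
   the other hand d_A(t) >= lambda^t for the second eigenvalue lambda, which the trace of A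
   bounds away from 0 because |G| >= pi^r > 2r+1; so d_A is still bounded below at twice
   that time, and t_A(eps) >= 2 t_A(1 - eps) for some eps depending only on r. *)
Require Import Defs.
From HB Require Import structures.
From mathcomp Require Import all_boot all_order all_algebra all_fingroup.
From mathcomp Require Import all_field all_character.
From mathcomp Require Import ring lra zify.

Set Implicit Arguments.
Unset Strict Implicit.
Unset Printing Implicit Defensive.
Import Order.TTheory GRing.Theory Num.Theory.
Local Open Scope ring_scope.

(** * Real estimates *)

Section RealEstimates.
Variable R : realFieldType.

(** The partial sums stay below the sequence 3 - 3/(B+1), whose increments dominate 1/(1+B^2) at
    every natural B. *)
Lemma sum_inv_sqr (B : nat) : \sum_(n < B) ((1 + n ^ 2)%:R^-1 : R) <= 3%:R.
Proof.
suff : \sum_(n < B) ((1 + n ^ 2)%:R^-1 : R) <= 3%:R - 3%:R / B.+1%:R.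
  by move=> /le_trans; apply; rewrite lerBlDr lerDl divr_ge0.
elim: B => [|B IH]; first by rewrite big_ord0 divr1 subrr.
rewrite big_ord_recr /=; apply: (le_trans (lerD IH (lexx _))).
rewrite natrD natrX -[B.+2%:R]natr1 -[B.+1%:R]natr1.
have := ler0n R B; set b : R := B%:R => b0.
(* Integrality matters: the numerator (b-1)(2b-1) below is negative for b strictly between 1/2 and
   1. *)
have b1 : b <= 0 \/ 1 <= b.
  by rewrite /b; case: (B) => [|k]; [left|right; rewrite ler1n].
rewrite -subr_ge0.
have -> : 3 - 3 / (b + 1 + 1) - (3 - 3 / (b + 1) + (1 + b ^+ 2)^-1)
   = ((b - 1) * (2 * b - 1)) / ((b + 1) * (b + 1 + 1) * (1 + b ^+ 2)).
  by field; rewrite ?lt0r_neq0 //; nra.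
by apply: divr_ge0; [case: b1 => ?; nra | rewrite !mulr_ge0 //; nra].
Qed.

Lemma bernoulli (h : R) n : 0 <= h -> 1 + n%:R * h <= (1 + h) ^+ n.
Proof.
move=> h0; elim: n => [|n IH]; first by rewrite mul0r addr0 expr0.
rewrite exprS -natr1; have := ler0n R n; nra.
Qed.

Lemma bernoulli_sub (h : R) n : 0 <= h <= 1 -> 1 - n%:R * h <= (1 - h) ^+ n.
Proof.
move=> h0; elim: n => [|n IH]; first by rewrite mul0r subr0 expr0.
have := ler0n R n; rewrite exprS -natr1; nra.
Qed.

Lemma exp_sub_le_inv (h : R) n : 0 <= h <= 1 -> (1 - h) ^+ n <= (1 + n%:R * h)^-1.
Proof.
move=> /andP[h0 h1]; have n0 := ler0n R n.
rewrite -div1r ler_pdivlMr; last by nra.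
apply: (le_trans (ler_wpM2l _ (bernoulli n h0))).
  by apply: exprn_ge0; lra.
by rewrite -exprMn exprn_ile1; nra.
Qed.

(** Signs [s] and sizes [n] label a cell of a grid with axes [J]. Distinct indices have distinct
    cells, so the sum is part of the sum over all cells, which factors into one sum per axis, each
    at most 2 * 3. *)
Lemma sum_injective_cells (I J : finType) (A : pred I)
    (s : I -> J -> bool) (n : I -> J -> nat) :
  (forall i j, s i =1 s j -> n i =1 n j -> i = j) ->
  \sum_(i | A i) \prod_l ((1 + n i l ^ 2)%:R^-1 : R) <= 6%:R ^+ #|J|.
Proof.
move=> inj; pose B := (\max_i \max_l n i l).+1.
have nB i l : (n i l < B)%N.
  by rewrite ltnS (leq_trans _ (leq_bigmax i)) // (leq_trans _ (leq_bigmax l)).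
pose c i : {ffun J -> bool * 'I_B} := [ffun l => (s i l, Ordinal (nB i l))].
have c_inj : injective c.
  by move=> i j /ffunP e; apply: inj => l; have := e l; rewrite !ffunE => -[].
pose w (b : bool * 'I_B) : R := (1 + b.2 ^ 2)%:R^-1.
have w0 b : 0 <= w b by rewrite invr_ge0.
have wc i : \prod_l ((1 + n i l ^ 2)%:R^-1 : R) = \prod_l w (c i l).
  by apply: eq_bigr => l _; rewrite /w ffunE.
have -> : 6%:R ^+ #|J| = \prod_(l : J) (6%:R : R) by rewrite prodr_const.
apply: (@le_trans _ _ (\prod_(l : J) \sum_b w b)); last first.
  apply: ler_prod => l _; rewrite sumr_ge0 //=.
  rewrite -(pair_bigA _ (fun (e : bool) (k : 'I_B) => w (e, k))) /= big_bool /= /w /=.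
  have := sum_inv_sqr B; lra.
rewrite bigA_distr_bigA /=.
under eq_bigr do rewrite wc.
rewrite -(big_imset (fun f => \prod_l w (f l)) (h := c) (A := A)) /=; last first.
  by move=> ????; apply: c_inj.
rewrite [X in _ <= X](bigID (mem (c @: A))) /= lerDl.
by apply: sumr_ge0 => f _; apply: prodr_ge0.
Qed.

End RealEstimates.

(** [T] is the least positive integer with 4gT >= 1. Either T = 1, or 4g(T-1) < 1 with T <= 2(T-1),
    so gT < 1/2 and Bernoulli gives (1-g)^T >= 1/2 >= m. *)
Lemma relaxation_time (R : archiRealFieldType) (g m : R) :
  0 < g -> 0 <= m -> m <= 1 - g -> 2 * m <= 1 ->
  exists T : nat, [/\ (0 < T)%N, 1 <= 4 * g * T%:R & m <= (1 - g) ^+ T].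
Proof.
move=> g0 m0 mg m2; have exT : exists T : nat, (0 < T)%N && (1 <= 4 * g * T%:R).
  exists (Num.truncn (4 * g)^-1).+1 => /=.
  have g4 : 0 < 4 * g by lra.
  have /andP[_ /ltW] := truncn_itv (ltW (etrans (invr_gt0 _) g4)).
  by rewrite -div1r ler_pdivrMr // mulrC.
have [T /andP[T0 gT] minT] := ex_minnP exT; exists T; split=> //.
have [->|T1] := eqVneq T 1%N; first by rewrite expr1.
have := contraNN (minT T.-1); rewrite -ltnNge ltn_predL T0 => /(_ isT).
rewrite negb_and -leqNgt leqn0 -subn1 subn_eq0 leqNgt ltn_neqAle eq_sym T1 T0 /=.
rewrite -ltNge natrB // => gT'.
apply: le_trans (bernoulli_sub _ _); last by apply/andP; split; lra.
have : 2%:R <= T%:R :> R by rewrite ler_nat; lia.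
by move: (T%:R) gT' => u; nra.
Qed.

(** Cauchy-Schwarz, from the nonnegativity of the variance of [f]. *)
Lemma sqr_sum_le (R : realFieldType) (T : finType) (f : T -> R) :
  (\sum_x f x) ^+ 2 <= #|T|%:R * \sum_x f x ^+ 2.
Proof.
have [T0|T0] := posnP #|T|.
  rewrite big1 ?expr0n ?T0 ?mul0r // => x _.
  by have := card0_eq T0 x; rewrite inE.
set S := \sum_x f x; pose n : R := #|T|%:R.
have n0 : 0 < n by rewrite ltr0n.
have : 0 <= \sum_x (f x - S / n) ^+ 2 by apply: sumr_ge0 => x _; apply: sqr_ge0.
have -> : \sum_x (f x - S / n) ^+ 2 = \sum_x f x ^+ 2 - S ^+ 2 / n.
  under eq_bigr do rewrite sqrrB -mulrnAl.
  rewrite big_split /= sumrB -mulr_suml sumr_const -[X in _ + X]mulr_natr.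
  rewrite sumrMnl -/S -/n /=; field; exact: lt0r_neq0.
by rewrite subr_ge0 ler_pdivrMr // mulrC.
Qed.

(** * Packing characters into cubes *)

Section SpectralSum.
(** In the application [v i] lists the real and imaginary parts of chi_i(a_l) - 1 and [o] is the
    trivial character; then [E i] is D(chi_i)^2 and 1 - E i / N the eigenvalue. *)
Variables (R : archiRcfType) (I J : finType) (o : I) (v : I -> J -> R) (r : nat).
Hypotheses (r_gt0 : (0 < r)%N) (cardJ : #|J| = (2 * r)%N).
Let E i := \sum_l v i l ^+ 2.
Local Notation N := ((2 * r).+1%:R : R).
Hypothesis E_le : forall i, E i <= (4 * r)%:R.

Variable E0 : R.
Hypotheses (E0_gt0 : 0 < E0) (E0_min : forall i, i != o -> E0 <= E i).
Hypothesis E0_sep : forall i j, i != j -> E0 <= \sum_l (v i l - v j l) ^+ 2.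

Local Notation rho := (r%:R : R).
Let rho1 : 1 <= rho. Proof. by rewrite ler1n. Qed.
Let NE : N = 2 * rho + 1. Proof. by rewrite -natr1 natrM. Qed.

Lemma E_ge0 i : 0 <= E i.
Proof. by rewrite sumr_ge0 // => l _; rewrite sqr_ge0. Qed.

(** The factor 1/(2r) accounts for negative eigenvalues: 1 - [rate i] must also dominate E i / N -
    1, with equality at the extreme value E i = 4r. *)
Let rate i := E i / (2 * rho * N).

Lemma rate_bounds i : 0 <= rate i <= 1.
Proof.
have p1 := rho1.
have e0 := E_ge0 i; have := E_le i; rewrite natrM  => e4.
rewrite /rate divr_ge0 //=; last by rewrite NE; nra.
by rewrite NE ler_pdivrMr; nra.
Qed.

Lemma abs_eigenvalue_le i : `|1 - E i / N| <= 1 - rate i.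
Proof.
have p1 := rho1.
have e0 := E_ge0 i; have := E_le i; rewrite natrM  => e4.
rewrite /rate NE ler_norml; apply/andP; split; rewrite -subr_ge0.
  have -> : 1 - E i / (2 * rho + 1) - - (1 - E i / (2 * rho * (2 * rho + 1)))
    = (2 * rho + 1) * (4 * rho - E i) / (2 * rho * (2 * rho + 1)).
    by field; apply/andP; split; apply: lt0r_neq0; nra.
  by apply: divr_ge0; nra.
have -> : 1 - E i / (2 * rho * (2 * rho + 1)) - (1 - E i / (2 * rho + 1))
    = (2 * rho - 1) * E i / (2 * rho * (2 * rho + 1)).
  by field; apply/andP; split; apply: lt0r_neq0; nra.
by apply: divr_ge0; nra.
Qed.

(** The side of the cubes, chosen so that the squared diagonal 2r * delta^2 equals E0/2, below the
    least squared distance. *)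
Let delta := Num.sqrt (E0 / (4 * rho)).
Let s i l := 0 <= v i l.
Let n i l := Num.truncn (`|v i l| / delta).

Let delta_gt0 : 0 < delta.
Proof. have p1 := rho1. by rewrite sqrtr_gt0 divr_gt0 //; lra. Qed.

Let delta2 : delta ^+ 2 = E0 / (4 * rho).
Proof. have p1 := rho1. by rewrite sqr_sqrtr // divr_ge0 ?ltW //; lra. Qed.

Lemma truncn_bounds i l : (n i l)%:R * delta <= `|v i l| < ((n i l)%:R + 1) * delta.
Proof.
have p1 := rho1.
have := truncn_itv (divr_ge0 (normr_ge0 (v i l)) (ltW delta_gt0)).
by rewrite -/(n i l) ler_pdivlMr // ltr_pdivrMr // -natr1.
Qed.

Lemma cells_injective i j : s i =1 s j -> n i =1 n j -> i = j.
Proof.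
have p1 := rho1.
move=> sij nij; apply/eqP; apply: contraT => /E0_sep.
have : \sum_l (v i l - v j l) ^+ 2 <= \sum_(l : J) delta ^+ 2.
  apply: ler_sum => l _; have := truncn_bounds i l; have := truncn_bounds j l.
  rewrite -(nij l) mulrDl mul1r; move: (_ * delta) => q bj bi; have := sij l; rewrite /s.
  have d0 := delta_gt0.
  case: (ger0P (v i l)) bi => hi /andP[??]; case: (ger0P (v j l)) bj => hj /andP[??] // _;
  rewrite -[_ ^+ 2]real_normK ?num_real // lerXn2r ?nnegrE ?normr_ge0 ?ltW // ltr_norml;
  by apply/andP; split; lra.
have -> : \sum_(l : J) delta ^+ 2 = E0 / 2.
  rewrite sumr_const cardJ -[LHS]mulr_natr natrM delta2.
  by field; apply: lt0r_neq0; lra.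
have := E0_gt0; lra.
Qed.

(** One coordinate gives n^2 delta^2 <= E i, that is n^2 <= 4r E i / E0; the summand 1 is absorbed
    by r E i / E0 >= 1. *)
Lemma cell_bound i l : i != o -> (1 + n i l ^ 2)%:R <= 5 * rho * (E i / E0) :> R.
Proof.
have p1 := rho1.
move=> /E0_min Ei; have e1 : 1 <= E i / E0 by rewrite ler_pdivlMr // mul1r.
have : (n i l)%:R ^+ 2 * delta ^+ 2 <= E i.
  have /andP[nv _] := truncn_bounds i l.
  have : v i l ^+ 2 <= E i.
    by rewrite /E (bigD1 l) //= lerDl sumr_ge0 // => k _; rewrite sqr_ge0.
  apply: le_trans; rewrite -exprMn -[X in _ <= X]real_normK ?num_real // lerXn2r ?nnegrE //.
  by rewrite mulr_ge0 // ltW.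
rewrite natrD natrX; set q := _ ^+ 2; rewrite delta2.
have -> : q * (E0 / (4 * rho)) = q * E0 / (4 * rho).
  by field; apply: lt0r_neq0; lra.
rewrite ler_pdivrMr; last by lra.
rewrite -ler_pdivlMr // => qE.
have -> : 5 * rho * (E i / E0) = rho * (E i / E0) + E i * (4 * rho) / E0.
  by field; apply: lt0r_neq0.
apply: lerD qE; nra.
Qed.

(** With x = 5r E i / E0, each block of [M] steps contributes a factor at most 1/(Kx). Of the 2r+1
    blocks, one supplies 1/K; the other 2r supply 1/x each, one for every coordinate, and
    [cell_bound] turns these into the summable cell weights. *)
Lemma spectral_sum_le (T K t : nat) :
  1 <= 4 * (E0 / N) * T%:R -> (0 < K)%N ->
  ((2 * r).+1 * (40 * r ^ 2 * K * T) <= t)%N ->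
  \sum_(i | i != o) (1 - E i / N) ^+ (2 * t) <= (6 ^ (2 * r))%:R / K%:R.
Proof.
have p1 := rho1.
move=> hT hK ht; set M := (40 * r ^ 2 * K * T)%N in ht.
have K1 : 1 <= K%:R :> R by rewrite ler1n.
have N0 : 0 < N by rewrite ltr0n.
suff term i : i != o ->
    (1 - E i / N) ^+ (2 * t) <= K%:R^-1 * \prod_l ((1 + n i l ^ 2)%:R^-1 : R).
  apply: le_trans (ler_sum _ term) _; rewrite -mulr_sumr mulrC.
  apply: ler_wpM2r; first by rewrite invr_ge0; lra.
  by rewrite natrX -cardJ; apply: sum_injective_cells cells_injective.
move=> io; have e1 : 1 <= E i / E0 by rewrite ler_pdivlMr // mul1r E0_min.
have rb := rate_bounds i; have [h0 h1] := andP rb.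
have b0 : 0 <= 1 - rate i by lra.
pose x := 5 * rho * (E i / E0); have x0 : 0 < x by rewrite /x; nra.
have step1 : (1 - E i / N) ^+ (2 * t) <= ((1 - rate i) ^+ M) ^+ (2 * r).+1.
  rewrite -exprM exprM -[_ ^+ 2]real_normK ?num_real // -exprM.
  apply: le_trans (_ : (1 - rate i) ^+ (2 * t) <= _).
    by rewrite lerXn2r ?nnegrE ?normr_ge0 ?abs_eigenvalue_le.
  by apply: ler_wiXn2l; [|lra|rewrite mulnC; lia].
have Mh : K%:R * x <= 1 + M%:R * rate i.
  (* The constant 40 r^2 in [M] is 5r * 4 * 2r: the factor in x, the one in the hypothesis on [T],
     and the denominator of [rate]. *)
  have -> : M%:R * rate i = (K%:R * x) * (4 * (E0 / N) * T%:R).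
    rewrite /M /rate /x !natrM ?natrX; field.
    by rewrite !lt0r_neq0 //=; lra.
  have Kx0 : 0 <= K%:R * x by nra.
  by rewrite (le_trans (ler_peMr Kx0 hT)) // lerDr ler01.
have step2 : (1 - rate i) ^+ M <= (K%:R * x)^-1.
  apply: le_trans (exp_sub_le_inv _ rb) _.
  by rewrite lef_pV2 ?posrE //; nra.
apply: le_trans step1 _.
apply: (@le_trans _ _ ((K%:R * x)^-1 ^+ (2 * r).+1)).
  by rewrite lerXn2r ?nnegrE ?exprn_ge0 // invr_ge0; nra.
have xK : x <= K%:R * x by nra.
rewrite exprS; apply: (@le_trans _ _ (K%:R^-1 * x^-1 ^+ (2 * r))).
  apply: ler_pM; rewrite ?exprn_ge0 ?invr_ge0 //; try by nra.
    rewrite lef_pV2 ?posrE; try by nra.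
    have : 1 <= x by rewrite /x; nra.
    by nra.
  rewrite lerXn2r ?nnegrE ?invr_ge0 //; try by nra.
  by rewrite lef_pV2 ?posrE //; nra.
apply: ler_wpM2l; first by rewrite invr_ge0; lra.
have -> : x^-1 ^+ (2 * r) = \prod_(l : J) x^-1 by rewrite prodr_const cardJ.
apply: ler_prod => l _; rewrite invr_ge0 ltW //=.
by rewrite lef_pV2 ?posrE ?ltr0n // cell_bound.
Qed.

End SpectralSum.

(** * Fourier analysis of the walk *)

Section Characters.
Variables (G : finZmodType).
Implicit Types (x y : G) (i j : Iirr [set: G]).

Lemma lin_irr_zmod i : 'chi_i \is a linear_char.
Proof. exact/char_abelianP/FinRing.zmod_abelian. Qed.

Lemma irrD i x y : 'chi_i (x + y) = 'chi_i x * 'chi_i y.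
Proof. by apply: (lin_charM (lin_irr_zmod i)); rewrite inE. Qed.

Lemma irrN i x : 'chi_i (- x) = ('chi_i x)^*.
Proof. by apply: (lin_charV_conj (lin_irr_zmod i)); rewrite inE. Qed.

Lemma irr_zero i : 'chi_i (0 : G) = 1.
Proof. exact: lin_char1 (lin_irr_zmod i). Qed.

Lemma irr0_val x : 'chi[[set: G]]_0 x = 1.
Proof. by rewrite irr0 cfun1E inE. Qed.

Lemma norm_irr i x : `|'chi_i x| = 1.
Proof. by apply: (normC_lin_char (lin_irr_zmod i)); rewrite inE. Qed.

(** The sum is the regular character, as every irreducible character has degree 1. *)
Lemma sum_irr x : \sum_i 'chi[[set: G]]_i x = #|G|%:R * (x == 0)%:R.
Proof.
have := cfRegE [set: G] x; rewrite cfReg_sum sum_cfunE cardsT -mulr_natr => <-.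
by apply: eq_bigr => i _; rewrite cfunE (irr_zero i) mul1r.
Qed.

Lemma parseval (f : G -> algC) :
  \sum_x `|f x| ^+ 2 = #|G|%:R^-1 * \sum_i `|\sum_x f x * ('chi[[set: G]]_i x)^*| ^+ 2.
Proof.
have cf : is_class_fun <<[set: G]>>%G (finfun f).
  apply: intro_class_fun => [x y _ _|x]; last by rewrite /= genGid inE.
  by rewrite conjgE FinRing.zmod_mulgC -mulgA mulgV mulg1.
pose phi : 'CF([set: G]) := Cfun 0 cf.
have phiE x : phi x = f x by rewrite cfunE.
have N0 : #|G|%:R != 0 :> algC by rewrite pnatr_eq0 -lt0n; apply/card_gt0P; exists 0.
have dotE (psi : 'CF([set: G])) :
    '[phi, psi] = #|G|%:R^-1 * \sum_x f x * (psi x)^*.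
  rewrite cfdotE cardsT; congr (_ * _).
  by apply: eq_big => x; rewrite ?inE // phiE.
have := cfdot_sum_irr phi phi; rewrite dotE.
under eq_bigr do rewrite phiE -normCK.
under [X in _ = X -> _]eq_bigr do rewrite -normCK dotE normrM exprMn.
rewrite -mulr_sumr => /(congr1 ( *%R #|G|%:R)); rewrite mulVKf // => ->.
rewrite ger0_norm ?invr_ge0 // mulrA; congr (_ * _).
by rewrite expr2 mulrA divff // mul1r.
Qed.

Variables (r : nat) (a : 'I_r -> G).
Local Notation N := ((2 * r).+1%:R : algC).

(* The squared distance to 1 for an invariant metric on the dual group. *)
Definition energy i : algC := \sum_(l < r) `|'chi_i (a l) - 1| ^+ 2.

Definition eigenval i : algC := 1 - energy i / N.

Lemma energyE i : energy i = \sum_(l < r) (2%:R - 'chi_i (a l) - ('chi_i (a l))^*).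
Proof.
apply: eq_bigr => l _; rewrite normCK rmorphB rmorph1 /=.
have := normCK ('chi_i (a l)); rewrite norm_irr expr1n.
move: ('chi_i _) => z; move: (z^*) => w zw.
have -> : (z - 1) * (w - 1) = z * w - z - w + 1 by ring.
by rewrite -zw; ring.
Qed.

Lemma eigenvalE i : eigenval i = N^-1 * (1 + \sum_(l < r) ('chi_i (a l) + ('chi_i (a l))^*)).
Proof.
have N0 : N != 0 by rewrite pnatr_eq0.
have sumE : \sum_(l < r) ('chi_i (a l) + ('chi_i (a l))^*) = N - 1 - energy i.
  have -> : N - 1 = \sum_(l < r) 2%:R :> algC.
    by rewrite sumr_const card_ord mulrSr addrK mulrnA.
  by rewrite energyE -sumrB; apply: eq_bigr => l _; ring.
by rewrite sumE addrA [1 + _]addrC subrK mulrBr mulVf // mulrC.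
Qed.

Lemma eigenval_real i : eigenval i \is Num.real.
Proof.
rewrite rpredB ?rpred1 // rpred_div ?rpred_nat // rpred_sum // => l _.
by rewrite rpredX ?normr_real.
Qed.

Lemma walk_transform i t :
  \sum_x ratr (walk_dist a t x) * ('chi_i x)^* = eigenval i ^+ t.
Proof.
elim: t => [|t IH].
  rewrite (bigD1 0) //= ffunE eqxx irr_zero rmorph1 mul1r rmorph1 big1 ?addr0 // => x xn0.
  by rewrite ffunE (negPf xn0) rmorph0 mul0r.
pose p x : algC := ratr (walk_dist a t x).
(* Translation by [b] multiplies the Fourier coefficient by the conjugate of chi_i(b), so one step
   of the walk multiplies it by the eigenvalue. *)
have shift (b : G) : \sum_x p (x - b) * ('chi_i x)^* = ('chi_i b)^* * eigenval i ^+ t.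
  rewrite -IH mulr_sumr (reindex_inj (addIr b)); apply: eq_bigr => x _ /=.
  by rewrite addrK irrD rmorphM /= mulrCA mulrA; ring.
under eq_bigr => x _.
  rewrite ffunE rmorphM rmorphD rmorph_sum /= fmorphV rmorph_nat.
  under eq_bigr do rewrite rmorphD /= -/(p _) -/(p _) -[X in _ + p (_ + X)]opprK.
  rewrite -/(p x) -mulrA mulrDl mulr_suml.
  over.
rewrite -mulr_sumr big_split /= IH exchange_big /=.
under eq_bigr => l _.
  under eq_bigr do rewrite mulrDl.
  rewrite big_split /= !shift -mulrDl irrN conjCK addrC.
  over.
by rewrite -mulr_suml exprS eigenvalE; ring.
Qed.

(** A trace bound: the holding step contributes |G|/N, and each step by a generator or its inverse
    contributes a nonnegative amount by [sum_irr]. *)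
Lemma sum_eigenval_ge : #|G|%:R / N <= \sum_i eigenval i.
Proof.
under eq_bigr do rewrite eigenvalE.
rewrite -mulr_sumr mulrC ler_pM2l ?invr_gt0 ?ltr0n // big_split /=.
rewrite -[X in X <= _]addr0 lerD //.
  have := sum_irr 0; rewrite eqxx mulr1 => <-.
  by apply: ler_sum => i _; rewrite irr_zero.
rewrite exchange_big sumr_ge0 //= => l _; rewrite big_split /= addr_ge0 //.
  by rewrite sum_irr mulr_ge0.
by under eq_bigr do rewrite -irrN; rewrite sum_irr mulr_ge0.
Qed.

Lemma energy_ge0 i : 0 <= energy i.
Proof. by rewrite sumr_ge0 // => l _; rewrite exprn_ge0. Qed.

Lemma energy0 : energy 0 = 0.
Proof. by apply: big1 => l _; rewrite irr0_val subrr normr0 expr0n. Qed.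

Lemma energy_le i : energy i <= (4 * r)%:R.
Proof.
rewrite mulnC natrM mulr_natl -[r in X in _ <= X]card_ord -sumr_const.
apply: ler_sum => l _; have -> : 4%:R = 2%:R ^+ 2 :> algC by rewrite -natrX.
apply: lerXn2r; rewrite ?qualifE /= ?normr_ge0 //.
by rewrite (le_trans (ler_normB _ _)) // norm_irr normr1.
Qed.

Lemma energy_eq0 i : generates a -> energy i = 0 -> i = 0.
Proof.
move=> gen /eqP; rewrite psumr_eq0; last by move=> l _; rewrite exprn_ge0.
move=> /allP e0; have a1 l : 'chi_i (a l) = 1.
  have := e0 l (mem_index_enum _); rewrite expf_eq0 normr_eq0 subr_eq0 => /andP[_ /eqP //].
apply: irr_inj; apply/cfun_inP => x _; rewrite irr0_val.
have [c ->] := gen x; elim/big_rec: _ => [|l y _ IH]; first exact: irr_zero.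
have nat1 n : 'chi_i (a l *+ n) = 1.
  by elim: n => [|n IHn]; rewrite ?mulr0n ?irr_zero // mulrS irrD a1 IHn mul1r.
rewrite irrD IH mulr1; case: (c l) => n; first exact: nat1.
by rewrite NegzE mulrNz irrN nat1 rmorph1.
Qed.

(** Invariance of the metric on the dual group: [k] is the quotient chi_i / chi_j, the inverse being
    the conjugate. *)
Lemma energy_sub i j : exists k : Iirr [set: G],
  energy k = \sum_(l < r) `|'chi_i (a l) - 'chi_j (a l)| ^+ 2 /\ (k = 0 -> i = j).
Proof.
have lin : 'chi[[set: G]]_i * ('chi_j)^*%CF \is a linear_char.
  by rewrite rpredM ?cfConjC_lin_char ?lin_irr_zmod.
have /irrP[k kE] := lin_char_irr lin.
have kx x : 'chi_k x = 'chi_i x * ('chi_j x)^* by rewrite -kE !cfunE.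
have dist x : `|'chi_k x - 1| = `|'chi_i x - 'chi_j x|.
  rewrite kx -[LHS]mulr1 -[X in _ * X](norm_irr j x) -normrM mulrBl mul1r -mulrA.
  by rewrite [_^* * _]mulrC -normCK norm_irr expr1n mulr1.
exists k; split; first by apply: eq_bigr => l _; rewrite dist.
move=> k0; apply: irr_inj; apply/cfun_inP => x _; apply/eqP.
by rewrite -subr_eq0 -normr_eq0 -dist k0 irr0_val subrr normr0.
Qed.

End Characters.

(** * Distance to uniformity and the spectral gap *)

Section Walk.
Variables (G : finZmodType) (r : nat) (a : 'I_r -> G).
Implicit Types (x y : G) (i j : Iirr [set: G]).
Local Notation N := ((2 * r).+1%:R : algC).
Local Notation dev t x := (ratr (walk_dist a t x - #|G|%:R^-1) : algC).

Lemma card_zmod_gt0 : (0 < #|G|)%N.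
Proof. by apply/card_gt0P; exists 0. Qed.

Lemma sum_irr_eq0 i : i != 0 -> \sum_x ('chi_i x)^* = 0.
Proof.
move=> i0; have := cfdot_irr 0 i; rewrite eq_sym (negPf i0) cfdotE => /eqP.
rewrite mulf_eq0 invr_eq0 pnatr_eq0 cardsT -leqn0 leqNgt card_zmod_gt0 /=.
move=> /eqP sum0; rewrite -[RHS]sum0.
by apply: eq_big => x; rewrite ?inE // irr0_val mul1r.
Qed.

Lemma deviation_transform i t :
  \sum_x dev t x * ('chi_i x)^* = if i == 0 then 0 else eigenval a i ^+ t.
Proof.
under eq_bigr do rewrite rmorphB /= fmorphV rmorph_nat mulrBl.
rewrite sumrB walk_transform -mulr_sumr.
have [->|i0] := eqVneq i 0; last by rewrite sum_irr_eq0 // mulr0 subr0.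
under eq_bigr do rewrite irr0_val rmorph1.
rewrite sumr_const /eigenval energy0 mul0r subr0 expr1n mulVf ?subrr //.
by rewrite pnatr_eq0 -lt0n card_zmod_gt0.
Qed.

Lemma dA_ratE t : ratr (dA_rat a t) = \sum_x `|dev t x|.
Proof. by rewrite rmorph_sum /=; apply: eq_bigr => x _; rewrite ratr_norm. Qed.

(** A nontrivial character has modulus 1, so pairing it with the deviation from uniformity bounds
    the l^1 norm from below. *)
Lemma dA_lower i t : i != 0 -> eigenval a i ^+ t <= ratr (dA_rat a t).
Proof.
move=> i0; have := deviation_transform i t; rewrite (negPf i0) => <-.
rewrite dA_ratE; apply: le_trans (real_ler_norm _) _.
  by rewrite deviation_transform (negPf i0) rpredX // eigenval_real.
apply: le_trans (ler_norm_sum _ _ _) _; apply: ler_sum => x _.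
by rewrite normrM norm_conjC norm_irr mulr1.
Qed.

(** Cauchy-Schwarz passes from the l^1 to the l^2 norm, and Parseval turns the latter into the
    spectral sum. *)
Lemma dA_upper t :
  ratr (dA_rat a t) ^+ 2 <= \sum_(i | i != 0) eigenval a i ^+ (2 * t).
Proof.
have -> : \sum_(i | i != 0) eigenval a i ^+ (2 * t) = #|G|%:R * \sum_x `|dev t x| ^+ 2.
  rewrite parseval mulVKf ?pnatr_eq0 -?lt0n ?card_zmod_gt0 //.
  rewrite [RHS](bigD1 0) //= deviation_transform eqxx normr0 expr0n add0r.
  apply: eq_bigr => i i0; rewrite deviation_transform (negPf i0).
  by rewrite real_normK ?rpredX ?eigenval_real // -exprM mulnC.
have -> : \sum_x `|dev t x| ^+ 2 = ratr (\sum_x (walk_dist a t x - #|G|%:R^-1) ^+ 2).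
  rewrite rmorph_sum; apply: eq_bigr => x _.
  by rewrite rmorphXn /= real_normK // Creal_Crat // Crat_rat.
rewrite -(rmorph_nat (ratr : rat -> algC)) -rmorphM -rmorphXn ler_rat /=.
apply: le_trans (sqr_sum_le _) _; rewrite ler_wpM2l //.
by apply: ler_sum => x _; rewrite real_normK ?num_real.
Qed.

Hypothesis big : ((2 * r).+1 < #|G|)%N.

(** The nontrivial eigenvalues sum to at least |G|/N - 1 and number |G| - 1, so the largest is at
    least their mean. The mean is at least 1/N^2 because (|G| - N)N >= |G| - 1 once |G| >= N + 1. *)
Lemma spectral_gap : exists i0 : Iirr [set: G],
  [/\ i0 != 0, forall i, i != 0 -> energy a i0 <= energy a i
    & (N ^+ 2)^-1 <= eigenval a i0].
Proof.
have cardI : #|Iirr [set: G]| = #|G|.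
  by rewrite card_Iirr_abelian ?FinRing.zmod_abelian // cardsT.
have [i1 i1n0] : exists i : Iirr [set: G], i != 0.
  have [j j0|all0] := pickP (fun i : Iirr [set: G] => i != 0); first by exists j.
  have : (#|Iirr [set: G]| <= 1)%N.
    rewrite -(card1 (0 : Iirr [set: G])); apply/subset_leq_card/subsetP => i _.
    by rewrite inE; have := all0 i; case: eqP.
  by rewrite cardI; lia.
have [] := @real_arg_minP _ _ i1 (fun i => i != 0) (energy a) i1n0.
  by move=> i _; rewrite ger0_real // energy_ge0.
move=> i0 i0n0 min0; exists i0; split=> //.
have N0 : 0 < N by rewrite ltr0n.
have := sum_eigenval_ge a; rewrite (bigD1 0) //= [X in X + _]/eigenval energy0 mul0r subr0.
rewrite -lerBlDl => sum_ge.
have : \sum_(i | i != 0) eigenval a i <= (#|G|.-1)%:R * eigenval a i0.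
  rewrite -cardI -(cardC1 0) mulr_natl -sumr_const; apply: ler_sum => i /min0 le0.
  by rewrite lerD2l lerN2 ler_pM2r ?invr_gt0.
move=> /(le_trans sum_ge) le_ev.
have G1 : 0 < #|G|.-1%:R :> algC by rewrite ltr0n; lia.
rewrite -(ler_pM2l G1); apply: le_trans le_ev.
rewrite ler_pdivrMr ?exprn_gt0 //.
have -> : (#|G|%:R / N - 1) * N ^+ 2 = (#|G|%:R - N) * N.
  by rewrite expr2 mulrA mulrBl mul1r divfK ?lt0r_neq0.
rewrite -natrB 1?ltnW // -natrM ler_nat.
by rewrite mulnBl; nia.
Qed.

End Walk.

(** * Two-sided bounds in terms of the relaxation time *)

(** Both bounds refer to the same [T]: the upper one comes from packing, the lower one from lambda^T
    >= N^-2 raised to the power [k], lambda being the second eigenvalue. *)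
Lemma walk_bounds (r : nat) (G : finZmodType) (a : 'I_r -> G) :
  (0 < r)%N -> generates a -> ((2 * r).+1 < #|G|)%N ->
  exists T : nat, [/\ (0 < T)%N,
    forall K t, (0 < K)%N -> ((2 * r).+1 * (40 * r ^ 2 * K * T) <= t)%N ->
      dA_rat a t ^+ 2 <= (6 ^ (2 * r))%:R / K%:R
    & forall k t, (t <= k * T)%N ->
      (((2 * r).+1 ^ 2) ^ k)%:R^-1 <= dA_rat a t].
Proof.
move=> r0 gen big; have [i0 [i0n0 min0 gap]] := spectral_gap a big.
(* The packing argument needs an ordered field, so the points are given real coordinates in [algR];
   [algRval] carries the inequalities back to [algC]. *)
pose v (i : Iirr [set: G]) (l : bool * 'I_r) : algR :=
  if l.1 then in_algR (Creal_Re ('chi_i (a l.2))) - 1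
         else in_algR (Creal_Im ('chi_i (a l.2))).
have sum_v (i : Iirr [set: G]) (z : 'I_r -> algC) (w : bool * 'I_r -> algR) :
    (forall l, algRval (w (true, l)) = 'Re (z l) /\ algRval (w (false, l)) = 'Im (z l)) ->
    algRval (\sum_l w l ^+ 2) = \sum_l `|z l| ^+ 2.
  move=> wz; rewrite (eq_bigr (fun p => w (p.1, p.2) ^+ 2)); last by case.
  rewrite -(pair_bigA _ (fun b l => w (b, l) ^+ 2)) /= big_bool /=.
  rewrite !rmorph_sum -big_split; apply: eq_bigr => l _ /=.
  by rewrite !rmorphXn /= !(proj1 (wz l), proj2 (wz l)) normC2_Re_Im.
have vE i : algRval (\sum_l v i l ^+ 2) = energy a i.
  apply: sum_v => // l; rewrite /v /= !raddfB /=.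
  by rewrite (Creal_ReP _ (rpred1 _)) (Creal_ImP _ (rpred1 _)) subr0.
have v_sub i j : algRval (\sum_l (v i l - v j l) ^+ 2)
    = \sum_l `|'chi_i (a l) - 'chi_j (a l)| ^+ 2.
  apply: sum_v => // l; rewrite /v /= !raddfB /=.
  by split=> //; ring.
pose E0 := \sum_l v i0 l ^+ 2.
have algR_le (x y : algR) : (x <= y) = (algRval x <= algRval y) by [].
have E0_gt0 : 0 < E0.
  rewrite lt_neqAle sumr_ge0 ?andbT; last by move=> *; apply: sqr_ge0.
  apply: contraNneq i0n0 => /(congr1 algRval); rewrite vE /= => e0.
  by apply/eqP/(energy_eq0 gen).
have E0_min i : i != 0 -> E0 <= \sum_l v i l ^+ 2.
  by move=> /min0; rewrite algR_le !vE.
have E0_sep i j : i != j -> E0 <= \sum_l (v i l - v j l) ^+ 2.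
  move=> ij; have [k [kE k0]] := energy_sub a i j.
  rewrite algR_le vE v_sub -kE; apply: min0.
  by apply: contra_neq ij.
have E_le i : \sum_l v i l ^+ 2 <= (4 * r)%:R.
  by rewrite algR_le vE rmorph_nat energy_le.
have cardJ : #|{: bool * 'I_r}| = (2 * r)%N by rewrite card_prod card_bool card_ord.
pose N : algR := (2 * r).+1%:R.
have N0 : 0 < N by rewrite ltr0n.
have lamE i : algRval (1 - (\sum_l v i l ^+ 2) / N) = eigenval a i.
  by rewrite rmorphB fmorph_div rmorph1 rmorph_nat /= vE.
have lamXE i n : algRval ((1 - (\sum_l v i l ^+ 2) / N) ^+ n) = eigenval a i ^+ n.
  by rewrite -lamE; exact: rmorphXn.
have [T [T0 gT mT]] : exists T : nat, [/\ (0 < T)%N, 1 <= 4 * (E0 / N) * T%:R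
    & (N ^+ 2)^-1 <= (1 - E0 / N) ^+ T].
  apply: relaxation_time; rewrite ?divr_gt0 ?invr_ge0 ?sqr_ge0 //.
    by rewrite algR_le lamE fmorphV rmorphXn rmorph_nat.
  rewrite ler_pdivrMr ?exprn_gt0 // mul1r -natrX ler_nat.
  by clear -r0; nia.
exists T; split=> // [K t K0 tK | k t tk].
  rewrite -(ler_rat algC) rmorphXn /=; apply: le_trans (dA_upper _ _) _.
  have := spectral_sum_le r0 cardJ E_le E0_gt0 E0_min E0_sep gT K0 tK.
  rewrite algR_le rmorph_sum fmorph_div !rmorph_nat fmorph_div !rmorph_nat.
  apply: le_trans; apply: ler_sum => i _.
  by rewrite -lamXE.
rewrite -(ler_rat algC) fmorphV rmorph_nat /=; apply: le_trans (dA_lower _ _ i0n0).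
have gap0 : 0 <= 1 - E0 / N.
  by rewrite algR_le lamE rmorph0 (le_trans _ gap) // invr_ge0 exprn_ge0.
have : (((2 * r).+1 ^ 2) ^ k)%:R^-1 <= (1 - E0 / N) ^+ t.
  apply: (@le_trans _ _ ((1 - E0 / N) ^+ (k * T))); last first.
    apply: ler_wiXn2l => //; rewrite lerBlDr lerDl divr_ge0 // ltW //.
  rewrite [(k * T)%N]mulnC exprM !natrX -exprVn lerXn2r ?nnegrE ?exprn_ge0 //.
  by rewrite invr_ge0 exprn_ge0 // ltW.
by rewrite algR_le fmorphV rmorph_nat lamXE.
Qed.

(** * Comparison of mixing times *)

From Stdlib Require Import Reals Lra ClassicalEpsilon.
Import ssrnat.

Lemma INR_gt0 n : (0 < n)%N -> Rlt 0 (INR n).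
Proof. by move=> /ssrnat.ltP; apply: lt_0_INR. Qed.

(** For thresholds 1/n the comparison in either field amounts to the integer inequality denominator
    <= numerator * n; a negative numerator falsifies both sides. *)
Lemma rat_to_R_ge_inv (q : rat) (n : nat) :
  (0 < n)%N -> Rge (rat_to_R q) (Rinv (INR n)) <-> n%:R^-1 <= q.
Proof.
move=> n0.
have -> : (n%:R^-1 <= q) = (denq q <= numq q * n).
  rewrite -div1r ler_pdivrMr ?ltr0n // -{1}(divq_num_den q) mulrAC.
  by rewrite ler_pdivlMr ?ltr0z ?denq_gt0 // mul1r -[n%:R]/(n%:~R) -intrM ler_int.
rewrite /rat_to_R; case: (denq q) (denq_gt0 q) => // d; rewrite ltz_nat => d0 /=.
have n0' := INR_gt0 n0; have d0' := INR_gt0 d0.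
rewrite -INR_IZR_INZ /Rdiv; have := Rinv_l (INR n) (Rgt_not_eq _ _ n0').
have := Rinv_l (INR d) (Rgt_not_eq _ _ d0').
have := Rinv_0_lt_compat _ n0'; have := Rinv_0_lt_compat _ d0'.
move: (Rinv (INR n)) (Rinv (INR d)) => x y y0 x0 yd xn; case: (numq q) => p.
  rewrite /= -INR_IZR_INZ -PoszM lez_nat.
  have ndE : (d <= p * n)%N <-> (INR d <= INR p * INR n)%R.
    by rewrite -mult_INR; split=> [/ssrnat.leP/le_INR //|/INR_le/ssrnat.leP].
  have -> : (INR p * y >= x)%R <-> (INR d <= INR p * INR n)%R.
    have dE : INR d = ((x * INR n) * INR d)%R by rewrite xn Rmult_1_l.
    have pnE : (INR p * INR n = (INR p * (y * INR d)) * INR n)%R by rewrite yd Rmult_1_r.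
    have nd := Rmult_lt_0_compat _ _ n0' d0'.
    by split=> h; Lra.nra.
  by rewrite ndE.
split; last by rewrite NegzE; lia.
have p0 : Rlt (IZR (int_to_Z (Negz p))) 0 by apply: IZR_lt; rewrite /=; lia.
by move: (IZR _) p0 => z; Lra.nra.
Qed.

Lemma bounded_nat_has_max (P : nat -> Prop) (B t0 : nat) :
  P t0 -> (forall t, P t -> (t <= B)%coq_nat) ->
  exists t, P t /\ forall t', P t' -> (t' <= t)%coq_nat.
Proof.
move=> Pt0; elim: B => [|B IH] PB.
  by exists t0; split=> // t' /PB; have := PB _ Pt0; lia.
case: (classic (P B.+1)) => [PB1 | nPB]; first by exists B.+1.
apply: IH => t Pt; have := PB _ Pt; case: (eqVneq t B.+1) => [tE|]; last by lia.
by move: nPB; rewrite -tE.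
Qed.

(** [epsilon] meets its specification only if a maximum exists; a nonempty bounded set of times
    provides one. *)
Lemma tA_max (G : finZmodType) (r : nat) (a : 'I_r -> G) (d : R) (B t0 : nat) :
  Rge (dA a t0) d -> (forall t, Rge (dA a t) d -> (t <= B)%coq_nat) ->
  Rge (dA a (tA a d)) d /\ (forall t, Rge (dA a t) d -> (t <= tA a d)%coq_nat).
Proof.
move=> P0 PB; have [t maxt] := bounded_nat_has_max (P := fun t => Rge (dA a t) d) P0 PB.
(* The [0%N] in [tA] is a binary number, so epsilon ranges over [BinNums.N]. *)
pose isMax (t : BinNums.N) :=
  Rge (dA a t) d /\ forall t', Rge (dA a t') d -> (t' <= t)%coq_nat.
by apply: (epsilon_spec _ isMax); exists (bin_of_nat t); rewrite /isMax bin_of_natK.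
Qed.

(** Already 3^r >= 2r+1, and PI > 3 makes the inequality strict. This converts the size condition
    into the one needed for the gap. *)
Lemma pow_PI_gt r : (1 <= r)%N -> Rlt (INR (2 * r).+1) (Rpow_def.pow PI r).
Proof.
have pi3 : Rlt 3 PI by have := PI2_3_2; Lra.lra.
elim: r => // -[_ _|r IH _]; first by rewrite muln1 /=; Lra.lra.
have := IH isT; rewrite [(2 * r.+2)%N]mulnS !addSn add0n.
change (Rpow_def.pow PI r.+2) with (Rmult PI (Rpow_def.pow PI r.+1)).
move: (2 * r.+1)%N (Rpow_def.pow PI _) => m q; rewrite !S_INR => mq.
have m0 := pos_INR m.
have q0 : Rlt 0 q by Lra.lra.
have := Rmult_lt_compat_r q 3 PI q0 pi3; Lra.lra.
Qed.

Lemma dist_one_ge (x : R) : (x = 0 \/ 2 <= x -> 1 <= R_dist x 1)%R.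
Proof.
rewrite /R_dist => -[->|x2]; last by rewrite Rabs_right; Lra.lra.
by rewrite Rminus_0_l Rabs_Ropp Rabs_R1; Lra.lra.
Qed.

(** Past time C = c T, with c depending only on [r], the distance is below 1/2, so t_A(1-eps) <= C.
    At time 2C it is still at least N^(-4c), which is the choice of eps = 1/n, so t_A(eps) >= 2C. *)
Lemma mixing_ratio (r : nat) : (0 < r)%N -> exists n : nat, (4 <= n)%N /\
  forall (G : finZmodType) (a : 'I_r -> G), generates a -> ((2 * r).+1 < #|G|)%N ->
  (2 * tA a (Rminus 1 (Rinv (INR n))) <= tA a (Rinv (INR n)))%N.
Proof.
move=> r0; pose S := (6 ^ (2 * r))%N; pose c K := ((2 * r).+1 * (40 * r ^ 2 * K))%N.
have S0 : (0 < S)%N by rewrite expn_gt0.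
pose n := (((2 * r).+1 ^ 2) ^ (2 * c (5 * S * 2 ^ 2)))%N.
have n4 : (4 <= n)%N.
  have c0 : (0 < 2 * c (5 * S * 2 ^ 2))%N by rewrite /c !muln_gt0 expn_gt0 r0.
  have N0 : (0 < (2 * r).+1 ^ 2)%N by rewrite expn_gt0.
  by apply: leq_trans (leq_pexp2l N0 c0); rewrite expn1; nia.
exists n; split=> // G a gen big; set eps := Rinv (INR n).
have [T [T0 upper lower]] := walk_bounds r0 gen big.
have cE K : ((2 * r).+1 * (40 * r ^ 2 * K * T) = c K * T)%N by rewrite /c !mulnA.
have d0 t : 0 <= dA_rat a t by apply: sumr_ge0.
(* Taking K = 5 S m^2 gives d_A^2 <= 1/(5 m^2). The case m = 2 bounds t_A(1-eps); the case m = n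
   shows that t_A(eps) is a genuine maximum. *)
have small m t : (0 < m)%N -> (c (5 * S * m ^ 2) * T <= t)%N -> dA_rat a t < m%:R^-1.
  move=> m0 ht; rewrite -(ltr_pXn2r (ltn0Sn 1)) ?nnegrE ?invr_ge0 //.
  apply: le_lt_trans (upper (5 * S * m ^ 2)%N _ _ _) _.
  - by rewrite !muln_gt0 S0 ?expn_gt0 ?m0.
  - by rewrite cE.
  rewrite -/S exprVn -natrX ltr_pdivrMr ?ltr0n ?muln_gt0 ?S0 ?expn_gt0 ?m0 //.
  rewrite ltr_pdivlMl ?ltr0n ?expn_gt0 ?m0 // -natrM ltr_nat.
  by rewrite [(m ^ 2 * S)%N]mulnC -mulnA ltn_Pmull // !muln_gt0 S0 m0.
have n0 : (0 < n)%N by lia.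
have Rn4 : Rle 4 (INR n) by have /ssrnat.leP/le_INR := n4; rewrite /=; Lra.lra.
have e0 : Rlt 0 eps by apply: Rinv_0_lt_compat; Lra.lra.
have e4 : Rle eps (Rinv 4) by apply: Rinv_le_contravar; Lra.lra.
have e1 : Rge 1 eps by clear -e4; Lra.lra.
have e1' : Rge 1 (Rminus 1 eps) by clear -e0; Lra.lra.
have dge m t : (0 < m)%N -> Rge (dA a t) (Rinv (INR m)) ->
    (t <= c (5 * S * m ^ 2) * T)%coq_nat.
  move=> m0 /(rat_to_R_ge_inv _ m0) ge; apply/ssrnat.leP; apply: contraLR ge.
  by rewrite -ltnNge -ltNge => /ltnW /small; apply.
(* Time 0 belongs to both sets of times, so neither maximum is over an empty set. *)
have start : Rge (dA a 0) 1.
  have -> : 1%R = Rinv (INR 1) by rewrite Rinv_1.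
  apply/rat_to_R_ge_inv => //; rewrite invr1.
  by have := lower 0%N 0%N isT; rewrite expn0 invr1.
have [_ max_eps] := tA_max (Rge_trans _ _ _ start e1) (fun t => dge n t n0).
have half t : Rge (dA a t) (Rminus 1 eps) -> Rge (dA a t) (Rinv (INR 2)).
  by clear -e4; rewrite /=; Lra.lra.
have [ge_half _] := tA_max (Rge_trans _ _ _ start e1') (fun t ht => dge 2 t isT (half t ht)).
have /ssrnat.leP le1 := dge 2%N _ isT (half _ ge_half).
have /max_eps/ssrnat.leP le2 : Rge (dA a (2 * c (5 * S * 2 ^ 2)%N * T)%N) eps.
  by apply/(rat_to_R_ge_inv _ n0)/lower.
by rewrite (leq_trans _ le2) // -mulnA leq_mul2l le1.
Qed.

Theorem theorem1 (r : nat) (hr : (1 <= r)%N)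
  (G : nat -> finZmodType) (a : forall j : nat, 'I_r -> G j)
  (hgen : forall j : nat, generates (a j))
  (hsize : forall j : nat, Rle (Rpow_def.pow PI r) (INR #|G j|)) :
  exists eps : R, Rlt 0 eps /\ Rlt eps (Rdiv 1 2) /\
    ~ Un_cv (fun j : nat => Rdiv (INR (tA (a j) eps)) (INR (tA (a j) (Rminus 1 eps)))) 1%R.
Proof.
have [n [n4 ratio]] := mixing_ratio hr; exists (Rinv (INR n)).
have Rn4 : Rle 4 (INR n) by have /ssrnat.leP/le_INR := n4; rewrite /=; Lra.lra.
have e0 : Rlt 0 (Rinv (INR n)) by apply: Rinv_0_lt_compat; Lra.lra.
have e4 : Rle (Rinv (INR n)) (Rinv 4) by apply: Rinv_le_contravar; Lra.lra.
split=> //; split; first Lra.lra.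
(* Every ratio has distance at least 1 from 1, so radius 1 contradicts convergence at the first
   index it yields. *)
move=> /(_ 1%R Rlt_0_1)[j /(_ j (le_n j))]; apply: Rle_not_lt; apply: dist_one_ge.
have big : ((2 * r).+1 < #|G j|)%N.
  apply/ssrnat.ltP/INR_lt; have := hsize j; have := pow_PI_gt hr; Lra.lra.
have := ratio (G j) (a j) (hgen j) big; move: (tA _ (Rinv _)) (tA _ (Rminus 1 _)) => t2 t1.
(* If t_A(1-eps) = 0, the convention 1/0 = 0 makes the ratio 0, again at distance 1 from the
   limit. *)
case: t1 => [|t1] le12; first by left; rewrite /Rdiv /= Rinv_0 Rmult_0_r.
right; have p1 := INR_gt0 (ltn0Sn t1).
have /ssrnat.leP/le_INR := le12; rewrite mult_INR => le.
apply: (Rmult_le_reg_r _ _ _ p1); rewrite /Rdiv Rmult_assoc Rinv_l; last Lra.lra.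
by move: le; rewrite Rmult_1_r.
Qed.
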